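(* In the setting described in the context, let $r:\mathbb R\to\mathbb R$ be a twice continuously differentiable convex function such that $$\inf_{t\in\mathbb R}r''(t)\ge0,\qquad\sup_{t\in\mathbb R}r''(t)<\infty,\qquad r(0)=r'(0)=r''(0)=0.$$ For every $i\in\{1,\dots,m\}$ put $l_i:=\inf\Pi_i\in[-\infty,\infty)$, $h_i:=\sup\Pi_i\in(-\infty,\infty]$, and define $\widetilde{\mathfrak f}_i(\cdot;r):\mathbb R\to\mathbb R$ by $$\widetilde{\mathfrak f}_i(t;r):=\begin{cases}\frac{\mathfrak f_i''(l_i)}{2}(t-l_i)^2+\mathfrak f_i'(l_i)(t-l_i)+\mathfrak f_i(l_i)+r(-t+l_i),&t\le l_i,\\ \mathfrak f_i(t),&l_i<t<h_i,\\ \frac{\mathfrak f_i''(h_i)}{2}(t-h_i)^2+\mathfrak f_i'(h_i)(t-h_i)+\mathfrak f_i(h_i)+r(t-h_i),&t\ge h_i.\end{cases}$$ Then for $\widetilde{\mathfrak f}(\cdot;r):\mathcal Y\to\mathbb R:u\mapsto\sum_{i=1}^m\widetilde{\mathfrak f}_i([u]_i;r)$ the following hold. (a) $\widetilde{\mathfrak f}(\cdot;r)$ is twice continuously differentiable over $\mathcal Y$ and $\nabla\widetilde{\mathfrak f}(\cdot;r)$ is Lipschitz continuous over $\mathcal Y$ with constant $$\max\Big\{\sup_{t\in\Pi_1}\mathfrak f_1''(t),\dots,\sup_{t\in\Pi_m}\mathfrak f_m''(t)\Big\}+\sup_{t\in\mathbb R}r''(t)<\infty.$$ (b) $\widetilde{\mathfrak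 f}(\cdot;r)$ is $1$-strongly convex relative to $q_\Lambda$ over $\mathcal Y$, i.e. $\widetilde{\mathfrak f}(\cdot;r)-q_\Lambda$ is convex. (c) $\mathfrak f(Ax)=\widetilde{\mathfrak f}(Ax;r)$ for every $x\in\mathfrak C^{-1}(\Delta)$. (d) If $\lim_{t\to+\infty}r(t)/t=\infty$, then $\widetilde{\mathfrak f}(\cdot;r)$ is coercive if $\mathfrak f$ is coercive, and $\widetilde{\mathfrak f}(\cdot;r)$ is bounded below if $\mathfrak f$ is bounded below.
   Context: Notation. $\Gamma_0(\mathcal H)$: proper lower semicontinuous convex functions $\mathcal H\to(-\infty,\infty]$; $\mathcal B(\mathcal H,\mathcal K)$: linear operators; $[u]_i$: $i$-th component of a vector $u$; $q_\Lambda(u)=\frac12\langle\Lambda u,u\rangle$. $\varphi\in\Gamma_0(\mathcal H)$ is coercive if $\varphi(x)\to\infty$ as $\|x\|\to\infty$. Setting. $\mathcal X,\mathcal Z,\widetilde{\mathcal Z},\mathfrak Z$ are finite-dimensional real Hilbert spaces and $\mathcal Y=\mathbb R^m$; $A\in\mathcal B(\mathcal X,\mathcal Y)$; $\Psi\in\Gamma_0(\mathcal Z)$ is coercive (and prox-friendly, i.e. with computable proximity operators); $\mathfrak L\in\mathcal B(\mathcal X,\mathcal Z)$; $\mu>0$; $B\in\mathcal B(\mathcal Z,\widetilde{\mathcal Z})$; $\Delta\subset\mathfrak Z$ is a closed convex set (simple, i.e. with computable projection); $\mathfrak C\in\mathcal B(\mathcal X,\mathfrak Z)$; $\operatorname{dom}(\Psi\circ\mathfrak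 L)\cap\mathfrak C^{-1}(\Delta)\neq\emptyset$. (Only $A$, $\mathfrak C$, $\Delta$ and the loss $\mathfrak f$ below enter the claim.) For $i\in\{1,\dots,m\}$ define the closed convex sets $$\Pi_i:=\Big\{t\in\mathbb R\ \Big|\ \inf_{\mathfrak Cx\in\Delta}[Ax]_i\le t\le\sup_{\mathfrak Cx\in\Delta}[Ax]_i\Big\}.$$ The observation loss function $\mathfrak f\in\Gamma_0(\mathcal Y)$ satisfies: (i) $\mathfrak f(u)=\sum_{i=1}^m\mathfrak f_i([u]_i)$, where each $\mathfrak f_i\in\Gamma_0(\mathbb R)$ is twice continuously differentiable over $\Pi_i$ and $\sup_{t\in\Pi_i}\mathfrak f_i''(t)<\infty$; (ii) the diagonal matrix $\Lambda\in\mathbb R^{m\times m}$ with $[\Lambda]_{i,i}:=\inf_{t\in\Pi_i}\mathfrak f_i''(t)\ge0$ is nonzero (hence a nonzero positive semidefinite matrix). *)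

(* Defs.v *)
From HB Require Import structures.
From mathcomp Require Import all_boot all_order all_algebra.
From mathcomp Require Import all_classical all_reals all_analysis.
Set Implicit Arguments.
Unset Strict Implicit.
Unset Printing Implicit Defensive.
Import Order.TTheory GRing.Theory Num.Theory.
Import numFieldNormedType.Exports.
Local Open Scope classical_set_scope.
Local Open Scope ring_scope.

(* Finite-dimensional real Hilbert spaces: the norm, hence the topology, is the
   one of the inner product; completeness follows from finite dimension. *)
HB.mixin Record isFinHilbert (R : realType) V
    of NormedModule R V & Vector R V := {
  inner : V -> V -> R ;
  innerC : forall x y, inner x y = inner y x ;
  innerDl : forall x y z, inner (x + y) z = inner x z + inner y z ;
  innerZl : forall a x y, inner (a *: x) y = a * inner x y ;
  inner_normE : forall x, inner x x = `|x| ^+ 2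
}.

#[short(type="finHilbertType")]
HB.structure Definition FinHilbert (R : realType) :=
  {V of NormedModule R V & Vector R V & isFinHilbert R V}.

Section Euclidean.
Context {R : realType} {m : nat}.
Implicit Types u v : 'rV[R]_m.

(* R^m is 'rV[R]_m.  Its library norm is the max norm: it has the right topology
   (and so the right differentials), but metric statements must use enorm. *)
Definition edot u v : R := \sum_(i < m) u 0 i * v 0 i.
Definition enorm u : R := Num.sqrt (edot u u).

(* q_M(u) = <M u, u> / 2; the column vector M u is the row vector u M^T. *)
Definition qform (M : 'M[R]_m) u : R := edot (u *m M^T) u / 2.

Definition grad (F : 'rV[R]_m -> R) u : 'rV[R]_m :=
  \row_(i < m) 'D_(delta_mx 0 i) F u.

Definition C2 (F : 'rV[R]_m -> R) : Prop :=
  [/\ forall u, differentiable F u,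
      forall u, differentiable (grad F) u
    & continuous (fun u => jacobian (grad F) u)].

End Euclidean.

Section Gamma0.
Context {R : realType}.
Local Open Scope ereal_scope.

Definition Gamma0 (V : normedModType R) (phi : V -> \bar R) : Prop :=
  [/\ forall x, phi x != -oo,
      exists x, phi x < +oo,
      lower_semicontinuous phi
    & forall (x y : V) (t : R), (0 < t < 1)%R ->
        phi (t *: x + (1 - t) *: y)%R <= t%:E * phi x + (1 - t)%:E * phi y].

(* The norm is a parameter because R^m is used with enorm. *)
Definition coercive (V : Type) (nrm : V -> R) (phi : V -> \bar R) : Prop :=
  forall M : R, exists rho : R, forall x, (rho < nrm x)%R -> M%:E < phi x.

Definition bounded_below (V : Type) (phi : V -> \bar R) : Prop :=
  exists c : R, forall x, c%:E <= phi x.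

End Gamma0.

Section OneDim.
Context {R : realType}.

(* The total operators derive1 and derive1n are only meaningful where g is
   differentiable, resp. twice differentiable; twice differentiability at t
   includes differentiability around t. *)
Definition C2_over (S : set R) (g : R -> R) : Prop :=
  [/\ forall t, S t -> \forall s \near t, derivable g s 1,
      forall t, S t -> derivable (derive1 g) t 1
    & {within S, continuous (derive1n 2 g)}].

(* An extended-valued function is differentiable at t only if it is finite
   around t; elsewhere fine returns a junk value. *)
Definition eC2_over (S : set R) (g : R -> \bar R) : Prop :=
  (forall t, S t -> \forall s \near t, g s \is a fin_num) /\
  C2_over S (fine \o g).

Local Open Scope ereal_scope.

Definition inf_d2 (S : set R) (g : R -> R) : \bar R :=
  ereal_inf [set (derive1n 2 g t)%:E | t in S].

Definition sup_d2 (S : set R) (g : R -> R) : \bar R :=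
  ereal_sup [set (derive1n 2 g t)%:E | t in S].

Definition taylor2 (g : R -> R) (a t : R) : R :=
  (derive1n 2 g a / 2 * (t - a) ^+ 2 + derive1 g a * (t - a) + g a)%R.

(* The branches involving fine l (resp. fine h) are reached only when the
   endpoint is finite, provided S is nonempty. *)
Definition extend (S : set R) (g : R -> \bar R) (r : R -> R) (t : R) : R :=
  let l := ereal_inf (EFin @` S) in
  let h := ereal_sup (EFin @` S) in
  if t%:E <= l then (taylor2 (fine \o g) (fine l) t + r (- t + fine l))%R
  else if t%:E < h then fine (g t)
  else (taylor2 (fine \o g) (fine h) t + r (t - fine h))%R.

Definition esep (m : nat) (g : 'I_m -> R -> \bar R) (u : 'rV[R]_m) : \bar R :=
  \sum_(i < m) g i (u ord0 i).

Definition sep (m : nat) (g : 'I_m -> R -> R) (u : 'rV[R]_m) : R :=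
  (\sum_(i < m) g i (u ord0 i))%R.

Definition Pi_set (X : Type) (m : nat) (D : set X) (A : X -> 'rV[R]_m)
    (i : 'I_m) : set R :=
  [set t | ereal_inf [set (A x ord0 i)%:E | x in D] <= t%:E
           <= ereal_sup [set (A x ord0 i)%:E | x in D]].

End OneDim.

(* Main.v *)
(* Let p be the projection onto Pi_i and q = p t. Each branch of the extension
   reads taylor2 f_i q t + r |t - q|, with first and second derivatives
     f_i''(q) (t - q) + f_i'(q) + sgn(t - q) r'(|t - q|),   f_i''(q) + r''(|t - q|).
   These formulas persist across the endpoints because near every t the map p is
   either constant or (when t lies in Pi_i) the identity, and the two candidate
   functions agree at t to the order required, thanks to r, r', r'' vanishing at 0.
   Smoothness, the Lipschitz constant and relative strong convexity are read off
   the second derivative.  Superlinearity of r beats the linear term of the Taylor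
   polynomial, so the extension is large outside a bounded set as soon as f_i is
   large there on Pi_i; freezing the other coordinates passes coercivity and
   lower bounds from f to each f_i. *)

Require Import Defs.
From HB Require Import structures.
From mathcomp Require Import all_boot all_order all_algebra.
From mathcomp Require Import all_classical all_reals all_analysis.
From mathcomp Require Import ring lra.
Set Implicit Arguments.
Unset Strict Implicit.
Unset Printing Implicit Defensive.
Import Order.TTheory GRing.Theory Num.Theory.
Import numFieldNormedType.Exports.
Local Open Scope classical_set_scope.
Local Open Scope ring_scope.

(** * Gluing of derivatives, and derivatives of functions of [|t|] *)

Lemma is_derive_cvgP (R : realType) (f : R -> R) (x d : R) :
  is_derive x 1 f d <-> h^-1 *: (f (h *: 1 + x) - f x) @[h --> 0^'] --> d.
Proof.
split => [fd|fd]; first by case: fd => fd dE; rewrite -dE; exact: fd.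
by apply: DeriveDef; [apply/cvg_ex; exists d|exact: cvg_lim].
Qed.

(** Since the three functions agree at [x], each difference quotient of [k] there is one of [f] or
    of [g], and both families tend to [d]. This handles points where the branch changes. *)
Lemma is_derive_glue (R : realType) (f g k : R -> R) (x d : R) :
    (\forall y \near x, k y = f y \/ k y = g y) -> k x = f x -> k x = g x ->
  is_derive x 1 f d -> is_derive x 1 g d -> is_derive x 1 k d.
Proof.
move=> kfg kf kg /is_derive_cvgP/cvgrPdist_le fd /is_derive_cvgP/cvgrPdist_le gd.
apply/is_derive_cvgP/cvgrPdist_le => e e0.
have kfg0 : \forall h \near 0^',
    k (h *: 1 + x) = f (h *: 1 + x) \/ k (h *: 1 + x) = g (h *: 1 + x).
  have: h *: 1 + x @[h --> (0 : R)] --> x.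
    rewrite -[X in _ --> X]add0r -[X in _ --> X + _](scale0r (1 : R)).
    by apply: cvgD; [exact: scalel_continuous|exact: cvg_cst].
  by move=> /(_ _ kfg); exact: nbhs_dnbhs.
near=> h.
have [->|->] : k (h *: 1 + x) = f (h *: 1 + x) \/ k (h *: 1 + x) = g (h *: 1 + x).
- by near: h.
- by rewrite kf; near: h; exact: fd.
- by rewrite kg; near: h; exact: gd.
Unshelve. all: by end_near. Qed.

(* [Num.sg x * r' `|x|] is the derivative of [r `|x|] including at 0, where
   [Num.sg 0 = 0]. *)
Lemma is_derive_comp_norm (R : realType) (r dr : R -> R) (x : R) :
    (forall y : R, is_derive y 1 r (dr y)) -> dr 0 = 0 ->
  is_derive x 1 (fun t => r `|t|) (Num.sg x * dr `|x|).
Proof.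
move=> rdr dr0.
have drN (y : R) : is_derive y 1 (fun t => r (- t)) (- dr (- y)).
  by apply: (@is_derive_eq _ _ _ _ _ _ _ (dr (- y) * -1)); rewrite ?mulrN1.
have [x0|x0|->] := ltgtP x 0.
- rewrite ltr0_sg// ltr0_norm// mulN1r.
  apply: near_eq_is_derive (drN x).
  by near=> t; rewrite ltr0_norm//; near: t; exact: lt_nbhsl.
- rewrite gtr0_sg// gtr0_norm// mul1r.
  apply: near_eq_is_derive (rdr x).
  by near=> t; rewrite gtr0_norm//; near: t; exact: lt_nbhsr.
- rewrite sgr0 mul0r.
  apply: (@is_derive_glue _ r (fun t => r (- t))); rewrite ?normr0 ?oppr0//.
  + by apply: filterE => t; have [t0|t0] := leP 0 t;
      [left; rewrite ger0_norm|right; rewrite ltr0_norm].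
  + by rewrite -[X in is_derive _ _ _ X]dr0.
  + by have := drN 0; rewrite oppr0 dr0 oppr0.
Unshelve. all: by end_near. Qed.

(** The function is the odd extension of [r] from the positive half-line; its halves [r t] and
    [- r (- t)] have the same slope at 0. Applied to [derive1 r], it differentiates the last term of
    [extend_d1]. *)
Lemma is_derive_sg_comp_norm (R : realType) (r dr : R -> R) (x : R) :
    (forall y : R, is_derive y 1 r (dr y)) -> r 0 = 0 -> dr 0 = 0 ->
  is_derive x 1 (fun t => Num.sg t * r `|t|) (dr `|x|).
Proof.
move=> rdr r0 dr0.
have drN (y : R) : is_derive y 1 (fun t => - r (- t)) (dr (- y)).
  have h : is_derive y 1 (fun t => r (- t)) (dr (- y) * -1).
    exact: (@is_derive1_comp _ r -%R y (dr (- y)) (-1)).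
  by have := is_deriveN h; rewrite mulrN1 opprK.
have [x0|x0|->] := ltgtP x 0.
- rewrite ltr0_norm//.
  apply: near_eq_is_derive (drN x).
  near=> t; have t0 : t < 0 by near: t; exact: lt_nbhsl.
  by rewrite ltr0_norm// ltr0_sg// mulN1r.
- rewrite gtr0_norm//.
  apply: near_eq_is_derive (rdr x).
  near=> t; have t0 : 0 < t by near: t; exact: lt_nbhsr.
  by rewrite gtr0_norm// gtr0_sg// mul1r.
- rewrite normr0.
  apply: (@is_derive_glue _ r (fun t => - r (- t)));
    rewrite ?sgr0 ?mul0r ?oppr0 ?r0 ?oppr0//.
  + apply: filterE => t; have [t0|t0|->] := ltgtP t 0.
    * by right; rewrite ltr0_norm// ltr0_sg// mulN1r.
    * by left; rewrite gtr0_norm// gtr0_sg// mul1r.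
    * by left; rewrite sgr0 mul0r r0.
  + by have := drN 0; rewrite oppr0.
Unshelve. all: by end_near. Qed.

(** * Projection onto a closed interval with possibly infinite endpoints *)

Lemma near_lt_ereal (R : realType) (t : R) (a : \bar R) :
  (t%:E < a)%E -> \forall s \near t, (s%:E < a)%E.
Proof.
case: a => [a| |]//.
- by rewrite lte_fin => ta; near do rewrite lte_fin; exact: lt_nbhsl.
- by move=> _; apply: filterE => s; exact: ltry.
Unshelve. all: by end_near. Qed.

Lemma near_gt_ereal (R : realType) (t : R) (a : \bar R) :
  (a < t%:E)%E -> \forall s \near t, (a < s%:E)%E.
Proof.
case: a => [a| |]//.
- by rewrite lte_fin => ta; near do rewrite lte_fin; exact: lt_nbhsr.
- by move=> _; apply: filterE => s; exact: ltNyr.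
Unshelve. all: by end_near. Qed.

(* The branches are those of [extend], so that with [q := itv_proj S t] it is
   [taylor2 g q t + r `|t - q|] (see [extendE]). *)
Definition itv_proj (R : realType) (S : set R) (t : R) : R :=
  let l := ereal_inf (EFin @` S) in
  let h := ereal_sup (EFin @` S) in
  if (t%:E <= l)%E then fine l else if (t%:E < h)%E then t else fine h.

Section ItvProj.
Context {R : realType} {S : set R} {a b : \bar R}.
Context (S_itv : S = [set t | (a <= t%:E <= b)%E]) (S0 : S !=set0).
Let l := ereal_inf (EFin @` S).
Let h := ereal_sup (EFin @` S).
Implicit Types s t : R.

Let inf_le s : S s -> (l <= s%:E)%E.
Proof. by move=> Ss; apply: ereal_inf_lbound; exists s. Qed.

Let sup_ge s : S s -> (s%:E <= h)%E.
Proof. by move=> Ss; apply: ereal_sup_ubound; exists s. Qed.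

Let lb_inf : (a <= l)%E.
Proof. by apply: le_ereal_inf_tmp => _ [s + <-]; rewrite S_itv => /andP[]. Qed.

Let sup_ub : (h <= b)%E.
Proof. by apply: ge_ereal_sup => _ [s + <-]; rewrite S_itv => /andP[]. Qed.

(** Closedness of [S] enters here: [a] and [b] enclose its infimum and supremum, so finite endpoints
    belong to [S]. *)
Let in_closure t : (l <= t%:E <= h)%E -> S t.
Proof.
by move=> /andP[lt th]; rewrite S_itv/= (le_trans lb_inf)// (le_trans th).
Qed.

Let inf_le_sup : (l <= h)%E.
Proof. by case: S0 => s Ss; exact: le_trans (inf_le Ss) (sup_ge Ss). Qed.

(** A point of [S] bounds [l] from above and [t] bounds it from below, so [fine l] is a genuine
    endpoint in the branch that uses it. *)
Let inf_fin t : (t%:E <= l)%E -> l = (fine l)%:E.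
Proof.
case: S0 => s /inf_le ls tl; rewrite fineK//.
by rewrite fin_real// (lt_le_trans (ltNyr t) tl) (le_lt_trans ls (ltry s)).
Qed.

Let sup_fin t : (h <= t%:E)%E -> h = (fine h)%:E.
Proof.
case: S0 => s /sup_ge sh ht; rewrite fineK//.
by rewrite fin_real// (lt_le_trans (ltNyr s) sh) (le_lt_trans ht (ltry t)).
Qed.

Lemma itv_proj_in t : S (itv_proj S t).
Proof.
rewrite /itv_proj -/l -/h; case: ifPn => [tl|]; last rewrite -ltNge => lt.
  by apply: in_closure; rewrite -(inf_fin tl) lexx inf_le_sup.
case: ifPn => [th|]; last rewrite -leNgt => ht.
  by apply: in_closure; rewrite !ltW.
by apply: in_closure; rewrite -(sup_fin ht) lexx inf_le_sup.
Qed.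

Lemma itv_proj_id t : S t -> itv_proj S t = t.
Proof.
move=> St; rewrite /itv_proj -/l -/h; case: ifPn => [tl|_].
  by rewrite (_ : l = t%:E)//; apply/eqP; rewrite eq_le tl inf_le.
case: ifPn => [//|]; rewrite -leNgt => ht.
by rewrite (_ : h = t%:E)//; apply/eqP; rewrite eq_le ht sup_ge.
Qed.

(** The alternative depends on [s]: at a finite endpoint of a nondegenerate [S], the projection is
    constant on the outer side and the identity on the inner side. *)
Lemma near_itv_proj t :
  \forall s \near t, itv_proj S s = itv_proj S t \/ S t /\ itv_proj S s = s.
Proof.
have [tl|lt] := leP t%:E l.
- have pt : itv_proj S t = fine l by rewrite /itv_proj tl.
  have lE := inf_fin tl.
  have [tl'|lt'] := ltP t%:E l.
    near=> s; left; rewrite pt /itv_proj ifT//; apply: ltW.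
    by near: s; exact: near_lt_ereal.
  have St : S t by apply: in_closure; rewrite lt' (le_trans tl).
  have [lh|hl] := ltP l h.
    near=> s; have [sl|ls] := leP s%:E l; first by left; rewrite pt /itv_proj sl.
    right; split => //; rewrite /itv_proj ifN -?ltNge// ifT//.
    by near: s; apply: near_lt_ereal; exact: le_lt_trans lh.
  (* Here [S] is a single point, so the projection is constant everywhere. *)
  apply: filterE => s; left; rewrite pt /itv_proj -/l -/h.
  have <- : l = h by apply/eqP; rewrite eq_le inf_le_sup.
  by case: ifPn => //; rewrite -ltNge => ls; rewrite ifN// -leNgt ltW.
- have ls : \forall s \near t, (l < s%:E)%E by exact: near_gt_ereal.
  have [th|ht] := ltP t%:E h.
    near=> s; right; split; first by apply: in_closure; rewrite !ltW.
    rewrite /itv_proj ifN; last by rewrite -ltNge; near: s.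
    by rewrite ifT//; near: s; exact: near_lt_ereal.
  have pt : itv_proj S t = fine h by rewrite /itv_proj ifN -?ltNge// ifN// -leNgt.
  have [ht'|th'] := ltP h t%:E.
    near=> s; left; rewrite pt /itv_proj ifN; last by rewrite -ltNge; near: s.
    rewrite ifN// -leNgt ltW//; near: s; exact: near_gt_ereal.
  near=> s; rewrite pt /itv_proj ifN; last by rewrite -ltNge; near: s.
  case: ifPn => _; last by left.
  by right; split => //; apply: in_closure; rewrite th' ltW.
Unshelve. all: by end_near. Qed.

Lemma continuous_itv_proj : continuous (itv_proj S).
Proof.
move=> t; apply/cvgrPdist_le => e e0.
near=> s.
have [->|[St ->]] : itv_proj S s = itv_proj S t \/ S t /\ itv_proj S s = s.
- by near: s; exact: near_itv_proj.
- by rewrite subrr normr0 ltW.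
- rewrite itv_proj_id//; near: s; exact: (cvgr_dist_le (@cvg_id _ (nbhs t))).
Unshelve. all: by end_near. Qed.

(** On the outer branches the sign of [t - q] is known, which turns the argument of [r] into
    [|t - q|]; on the middle branch [t = q] and only the constant Taylor term survives. *)
Lemma extendE (g : R -> \bar R) (r : R -> R) t : r 0 = 0 ->
  extend S g r t =
    taylor2 (fine \o g) (itv_proj S t) t + r `|t - itv_proj S t|.
Proof.
move=> r0; rewrite /extend /itv_proj -/l -/h; case: ifPn => [tl|_].
  congr (_ + r _); rewrite ler0_norm ?opprB; first by rewrite addrC.
  by rewrite subr_le0 -lee_fin -(inf_fin tl).
case: ifPn => [_|]; last rewrite -leNgt => ht.
  by rewrite /taylor2 subrr normr0 r0 expr0n !mulr0 !add0r addr0.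
congr (_ + r _); rewrite ger0_norm//.
by rewrite subr_ge0 -lee_fin -(sup_fin ht).
Qed.

End ItvProj.

(** Away from the identity branch only two centres of expansion occur, so a threshold depending on
    the centre can be made uniform by a maximum. *)
Lemma itv_proj_cases (R : realType) (S : set R) (t : R) :
  [\/ itv_proj S t = t, itv_proj S t = fine (ereal_inf (EFin @` S))
    | itv_proj S t = fine (ereal_sup (EFin @` S))].
Proof.
by rewrite /itv_proj; case: ifP => _; [|case: ifP => _];
  [apply: Or32|apply: Or31|apply: Or33].
Qed.

(** * First and second derivatives of the extension *)

Lemma is_derive_derive1 (R : realType) (f : R -> R) (t : R) :
  derivable f t 1 -> is_derive t 1 f (derive1 f t).
Proof. by move=> ft; rewrite derive1E; exact/derivableP. Qed.

Lemma is_derive_affine (R : realType) (c d a t : R) :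
  is_derive t 1 (fun s => c * (s - a) + d) c.
Proof.
have h : is_derive t 1 (c \*: (id - cst a) + cst d : R -> R) (c *: (1 - 0) + 0).
  by apply: is_deriveD.
by rewrite addr0 subr0 [_ *: _]mulr1 in h.
Qed.

Lemma is_derive_taylor2 (R : realType) (g : R -> R) (a t : R) :
  is_derive t 1 (taylor2 g a) (derive1n 2 g a * (t - a) + derive1 g a).
Proof.
have ha : is_derive t 1 (id - cst a : R -> R) 1.
  by apply: is_derive_eq; rewrite subr0.
have h : is_derive t 1 ((derive1n 2 g a / 2) \*: (id - cst a : R -> R) ^+ 2
    + (derive1 g a \*: (id - cst a) + cst (g a)))
  ((derive1n 2 g a / 2) *: ((2%:R * (t - a) ^+ 1) *: 1) + (derive1 g a *: 1 + 0)).
  apply: is_deriveD; first exact/is_deriveZ/is_deriveX.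
have -> : derive1n 2 g a * (t - a) + derive1 g a =
    (derive1n 2 g a / 2) *: ((2%:R * (t - a) ^+ 1) *: 1) + (derive1 g a *: 1 + 0).
  by rewrite /GRing.scale/=; field.
rewrite (_ : taylor2 g a = (derive1n 2 g a / 2) \*: (id - cst a : R -> R) ^+ 2
  + (derive1 g a \*: (id - cst a) + cst (g a))); first exact: h.
by apply/funext => s; rewrite /taylor2 -addrA.
Qed.

Section Extension.
Context {R : realType} {S : set R} {a b : \bar R}.
Context (S_itv : S = [set t | (a <= t%:E <= b)%E]) (S0 : S !=set0).
Context (g : R -> \bar R) (r : R -> R).
Local Notation g1 := (derive1 (fine \o g)).
Local Notation g2 := (derive1n 2 (fine \o g)).
Local Notation r1 := (derive1 r).
Local Notation r2 := (derive1n 2 r).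
Context (C2g : C2_over S (fine \o g)) (C2r : C2_over setT r).
Context (r_0 : r 0 = 0) (r1_0 : r1 0 = 0) (r2_0 : r2 0 = 0).
Local Notation p := (itv_proj S).

Definition extend_d1 (t : R) : R :=
  g2 (p t) * (t - p t) + g1 (p t) + Num.sg (t - p t) * r1 `|t - p t|.

Definition extend_d2 (t : R) : R := g2 (p t) + r2 `|t - p t|.

Let r_derive (t : R) : is_derive t 1 r (r1 t).
Proof.
case: C2r => /(_ t I) /nbhs_singleton rt _ _.
exact: is_derive_derive1.
Qed.

Let r1_derive (t : R) : is_derive t 1 r1 (r2 t).
Proof.
case: C2r => _ /(_ t I) rt _.
exact: is_derive_derive1.
Qed.

(** [C2_over] speaks of derivability in the whole line, so this is a two-sided derivative even at an
    endpoint of [S], as gluing requires. *)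
Let g_derive (t : R) : S t -> is_derive t 1 (fine \o g) (g1 t).
Proof.
case: C2g => + _ _ => /[apply] /nbhs_singleton gt.
exact: is_derive_derive1.
Qed.

Let g1_derive (t : R) : S t -> is_derive t 1 g1 (g2 t).
Proof.
case: C2g => _ + _ => /[apply] gt.
exact: is_derive_derive1.
Qed.

Let is_derive_shift_comp (u : R -> R) (q t d : R) :
  is_derive (t - q) 1 u d -> is_derive t 1 (fun s => u (s - q)) d.
Proof.
move=> ud; rewrite -[d]mulr1.
have h : is_derive t 1 (fun s => s - q) 1.
  have := is_derive_affine 1 0 q t.
  by under eq_fun do rewrite mul1r addr0.
exact: (@is_derive1_comp _ u (fun s => s - q) t d 1).
Qed.

(* Around [t], the projection is either constant or, if [S t], the identity. *)
Let is_derive_itv_proj (k u : R -> R) (v : R -> R -> R) (t d : R) :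
    (forall s, k s = v (p s) s) -> (forall s, S s -> k s = u s) ->
    is_derive t 1 (v (p t)) d -> (S t -> is_derive t 1 u d) ->
  is_derive t 1 k d.
Proof.
move=> kv ku vd ud; have [St|nSt] := pselect (S t).
  apply: (is_derive_glue _ (kv t) (ku t St) vd (ud St)).
  near=> s; have [ps|[_ ps]] : p s = p t \/ S t /\ p s = s.
  - by near: s; exact: near_itv_proj S_itv S0 t.
  - by left; rewrite kv ps.
  - by right; rewrite ku// -ps; exact: itv_proj_in S_itv S0 s.
apply: near_eq_is_derive vd.
near=> s; have [ps|[//]] : p s = p t \/ S t /\ p s = s.
  by near: s; exact: near_itv_proj S_itv S0 t.
by rewrite kv ps.
Unshelve. all: by end_near. Qed.

Lemma extend_id t : S t -> extend S g r t = fine (g t).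
Proof.
move=> St; rewrite (extendE S0)// (itv_proj_id St) /taylor2.
by rewrite subrr normr0 r_0 expr0n !mulr0 !add0r addr0.
Qed.

Lemma is_derive_extend (t : R) : is_derive t 1 (extend S g r) (extend_d1 t).
Proof.
(* The two-argument function is the extension with its centre of expansion frozen at [q]. *)
apply: (@is_derive_itv_proj (extend S g r) (fine \o g)
  (fun q s => taylor2 (fine \o g) q s + r `|s - q|) t (extend_d1 t)).
- by move=> s; rewrite (extendE S0).
- exact: extend_id.
- apply: is_deriveD; first exact: is_derive_taylor2.
  apply: (@is_derive_shift_comp (fun s => r `|s|)).
  exact: is_derive_comp_norm.
- move=> St; rewrite /extend_d1 itv_proj_id// subrr sgr0 mulr0 mul0r addr0 add0r.
  exact: g_derive.
Qed.

Lemma is_derive_extend_d1 (t : R) : is_derive t 1 extend_d1 (extend_d2 t).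
Proof.
apply: (@is_derive_itv_proj extend_d1 g1
  (fun q s => g2 q * (s - q) + g1 q + Num.sg (s - q) * r1 `|s - q|)
  t (extend_d2 t)).
- by [].
- by move=> s Ss; rewrite /extend_d1 itv_proj_id// subrr sgr0 mulr0 mul0r addr0 add0r.
- apply: is_deriveD; first exact: is_derive_affine.
  apply: (@is_derive_shift_comp (fun s => Num.sg s * r1 `|s|)).
  exact: is_derive_sg_comp_norm.
- move=> St; rewrite /extend_d2 itv_proj_id// subrr normr0 r2_0 addr0.
  exact: g1_derive.
Qed.

(** [g2] is continuous only within [S], but [p] is continuous with all its values in [S], so
    [g2 \o p] is continuous on the whole line. *)
Lemma continuous_extend_d2 : continuous extend_d2.
Proof.
case: C2g => _ _ /subspace_continuousP g2_cont.
have r2_cont : continuous r2.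
  by apply/continuous_subspace_setT; case: C2r.
have p_cont := continuous_itv_proj S_itv S0.
have g2p_cont : continuous (g2 \o p).
  move=> t; apply: (cvg_comp p g2); last exact/g2_cont/(itv_proj_in S_itv S0).
  move=> U /(p_cont t) pU.
  apply: (@filterS _ (nbhs t) _ (fun s => S (p s) -> U (p s)) _ _ pU) => s; apply.
  exact: itv_proj_in S_itv S0 s.
have d_cont : continuous (fun s => s - p s).
  by move=> t; apply: cvgB; [exact: cvg_id|exact: p_cont].
have r2d_cont : continuous (r2 \o (fun s => `|s - p s|)).
  move=> t; apply: continuous_comp; last exact: r2_cont.
  exact: cvg_norm (d_cont t).
by move=> t; exact: cvgD (g2p_cont t) (r2d_cont t).
Qed.

End Extension.

(** * Lipschitz and convexity criteria from derivatives *)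

Lemma lipschitz_of_derive (R : realType) (f df : R -> R) (C s t : R) :
    (forall x : R, is_derive x 1 f (df x)) -> (forall x, `|df x| <= C) ->
  `|f s - f t| <= C * `|s - t|.
Proof.
move=> fdf dfC; wlog ts : s t / t <= s.
  by move=> H; case/orP: (le_total t s) => /H //; rewrite distrC (distrC t).
have [|c _ ->] := @MVT_segment _ f df t s ts (fun x _ => fdf x).
  apply: continuous_subspaceT => x.
  apply: differentiable_continuous; apply/derivable1_diffP.
  by have [] := fdf x.
by rewrite normrM ler_wpM2r.
Qed.

Lemma derive2_ge0_convex (R : realType) (f f1 f2 : R -> R) :
    (forall x : R, is_derive x 1 f (f1 x)) ->
    (forall x : R, is_derive x 1 f1 (f2 x)) -> (forall x, 0 <= f2 x) ->
  convex_function setT (f : convex_lmodType R^o -> R^o).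
Proof.
move=> ff1 f1f2 f2_ge0.
have fc : continuous f.
  move=> x; apply: differentiable_continuous; apply/derivable1_diffP.
  by have [] := ff1 x.
have Df : 'D_1 f = f1 by apply/funext => x; have [] := ff1 x.
have H (a b : R^o) (t : {i01 R}) : a <= b ->
    f (conv t (a : convex_lmodType R^o) b) <= conv t (f a : convex_lmodType R^o) (f b).
  apply: second_derivative_convex.
  - by move=> x _; rewrite Df; have [_ ->] := f1f2 x.
  - by apply: cvg_at_left_filter; exact: fc.
  - by apply: cvg_at_right_filter; exact: fc.
  - by move=> x _; have [] := ff1 x.
  - by move=> x _; rewrite Df; have [] := f1f2 x.
(* [H] covers ordered endpoints; the other order follows by exchanging the weights. *)
move=> t x y _ _; have [xy|/ltW yx] := leP (x : R) y; first exact: H.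
by rewrite convC [leRHS]convC; exact: H.
Qed.

(** * Growth of the extension *)

Lemma taylor2_superlinear_gt (R : realType) (g r : R -> R) (q M : R) :
    r t / t @[t --> +oo] --> +oo -> 0 <= derive1n 2 g q ->
  exists rho : R, forall t, rho < `|t| -> M < taylor2 g q t + r `|t - q|.
Proof.
(* With this slope, [r] absorbs the linear Taylor term and still leaves a surplus of [|t - q|]. *)
move=> /cvgryPge/(_ (`|derive1 g q| + 1)) [s0 [_ rs]] g2_ge0.
(* The summand [|q|] passes from [|t|] to [|t - q|]; the maximum secures the growth of [r], a
   positive divisor, and a surplus larger than [M - g q]. *)
exists (`|q| + Num.max s0 (Num.max 0 (M - g q))) => t qt.
have : Num.max s0 (Num.max 0 (M - g q)) < `|t - q|.
  by have := lerB_dist t q; lra.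
rewrite !gt_max => /and3P[s0t t0 Mt].
have := rs _ s0t; rewrite /= ler_pdivlMr// => {}rs.
have d_le : - (`|derive1 g q| * `|t - q|) <= derive1 g q * (t - q).
  by rewrite -normrM lerNl -normrN ler_norm.
have : 0 <= derive1n 2 g q / 2 * (t - q) ^+ 2 by rewrite mulr_ge0 ?divr_ge0 ?sqr_ge0.
rewrite /taylor2; lra.
Qed.

Lemma gt_outside_bounded_below (R : realType) (f : R -> R) (M rho : R) :
    continuous f -> (forall t, rho < `|t| -> M < f t) ->
  exists c, forall t, c <= f t.
Proof.
(* Using [|rho|] keeps the compact interval nonempty when [rho] is negative. *)
move=> fc Mf; have rho0 : - `|rho| <= `|rho| by rewrite ge0_cp.
have [c _ cf] := EVT_min rho0 (@continuous_subspaceT _ _ _ _ fc).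
exists (Num.min M (f c)) => t; rewrite ge_min; have [tr|rt] := leP `|t| `|rho|.
  by rewrite cf ?orbT// in_itv/= -ler_norml.
by rewrite ltW// Mf// (le_lt_trans (ler_norm rho)).
Qed.

Lemma extend_gt (R : realType) (S : set R) (a b : \bar R)
    (g : R -> \bar R) (r : R -> R) (M : R) :
    S = [set t | (a <= t%:E <= b)%E] -> S !=set0 -> r 0 = 0 ->
    r t / t @[t --> +oo] --> +oo ->
    (forall t, S t -> 0 <= derive1n 2 (fine \o g) t) ->
    (exists rho : R, forall t, S t -> rho < `|t| -> M < fine (g t)) ->
  exists rho : R, forall t, rho < `|t| -> M < extend S g r t.
Proof.
move=> S_itv S0 r0 rlim g2_ge0 [rho0 Mg].
(* Fixing the centre [q] gives one threshold for all [t] projected to it. For an infinite endpoint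
   [fine] yields 0; if [q] lies outside [S], no point projects to it and any threshold works. *)
have bnd q : exists rho : R, forall t, itv_proj S t = q -> rho < `|t| ->
    M < extend S g r t.
  have [Sq|nSq] := pselect (S q).
    have [rho Mt] := taylor2_superlinear_gt M rlim (g2_ge0 q Sq).
    by exists rho => t tq /Mt; rewrite (extendE S0)// tq.
  by exists 0 => t tq; case: nSq; rewrite -tq; exact: itv_proj_in S_itv S0 t.
have [rho1 M1] := bnd (fine (ereal_inf (EFin @` S))).
have [rho2 M2] := bnd (fine (ereal_sup (EFin @` S))).
exists (Num.max rho0 (Num.max rho1 rho2)) => t; rewrite !gt_max => /and3P[t0 t1 t2].
have [pt|/M1|/M2] := itv_proj_cases S t; [|exact|exact].
have St : S t by rewrite -pt; exact: itv_proj_in S_itv S0 t.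
by rewrite (extend_id _ _ r0 St)// Mg.
Qed.

(** * Differential calculus of separable functions *)

Lemma continuous_sum (R : realType) (T : topologicalType) (W : normedModType R)
    (I : finType) (f : I -> T -> W) :
  (forall i, continuous (f i)) -> continuous (fun u => \sum_i f i u).
Proof.
move=> f_cont; elim: (index_enum _) => [|i s IH].
  by under eq_fun do rewrite big_nil; move=> u; exact: cvg_cst.
by under eq_fun do rewrite big_cons; move=> u; exact: cvgD (f_cont i u) (IH u).
Qed.

(** A continuous linear map is its own differential. *)
Lemma is_diff_coord (R : realType) (m : nat) (i : 'I_m) (u : 'rV[R]_m) :
  is_diff u (fun v : 'rV[R]_m => v 0 i : R) (fun v : 'rV[R]_m => v 0 i : R).
Proof.
have lin : linear (fun v : 'rV[R]_m => v 0 i : R^o).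
  by move=> k x y; rewrite !mxE.
pose coordM := GRing.isLinear.Build _ _ _ _ _ lin.
pose coord : {linear 'rV[R]_m -> R^o} := HB.pack (fun v : 'rV[R]_m => v 0 i : R^o) coordM.
apply: DiffDef; first exact: differentiable_coord.
exact: (@diff_lin _ _ _ coord u (@coord_continuous _ _ _ _ _)).
Qed.

Lemma is_derive_is_diff (R : realType) (f : R -> R) (t d : R) :
  is_derive t 1 f d -> is_diff t f (fun x => d * x).
Proof.
move=> [ft fd]; have dft : differentiable f t by apply/derivable1_diffP.
apply: DiffDef => //; apply/funext => x.
by rewrite -[x in LHS]mulr1 [LHS]linearZ -deriveE// fd [RHS]mulrC.
Qed.

Section Separable.
Context {R : realType} {m : nat}.
Context (G dG : 'I_m -> R -> R).
Context (GdG : forall i (t : R), is_derive t 1 (G i) (dG i t)).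

(** Vector weights let one computation serve twice: weights 1 give the separable function, basis
    vectors give its gradient. *)
Lemma is_diff_sum_coord (W : normedModType R) (w : 'I_m -> W) (u : 'rV[R]_m) :
  is_diff u (fun u => \sum_i G i (u 0 i) *: w i)
    (fun v => \sum_i (dG i (u 0 i) * v 0 i) *: w i).
Proof.
have H i : is_diff u (fun u : 'rV_m => G i (u 0 i) *: w i)
    (fun v => (dG i (u 0 i) * v 0 i) *: w i).
  have Gi : is_diff u (fun u : 'rV_m => G i (u 0 i) : R) (fun v => dG i (u 0 i) * v 0 i).
    exact: (is_diff_comp (is_diff_coord i u) (is_derive_is_diff (GdG i (u 0 i)))).
  apply: DiffDef; first exact/differentiableZl/(@ex_diff _ _ _ _ _ _ _ Gi).
  by rewrite diffZl ?(@diff_val _ _ _ _ _ _ _ Gi)//; exact: (@ex_diff _ _ _ _ _ _ _ Gi).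
rewrite -!(fct_sumE _ _ (fun i v => _ *: w i)).
elim/big_ind2 : _ => //.
- by apply: DiffDef; [exact: differentiable_cst|exact: diff_cst].
- by move=> f1 d1 f2 d2 h1 h2; exact: is_diffD.
Qed.

Lemma is_diff_sep (u : 'rV[R]_m) :
  is_diff u (sep G) (fun v => \sum_i dG i (u 0 i) * v 0 i).
Proof.
have := is_diff_sum_coord (fun=> 1 : R^o) u.
rewrite (_ : (fun u => _) = sep G); last first.
  by apply/funext => v; apply: eq_bigr => i _; rewrite [LHS]mulr1.
by under [X in is_diff _ _ X]eq_fun do under eq_bigr do rewrite [_ *: _]mulr1.
Qed.

Lemma grad_sep (u : 'rV[R]_m) : grad (sep G) u = \row_i dG i (u 0 i).
Proof.
have sG := is_diff_sep u; apply/rowP => i; rewrite !mxE deriveE ?diff_val//.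
rewrite (bigD1 i)//= big1 ?addr0 ?mxE ?eqxx ?mulr1//.
by move=> j ji; rewrite mxE (negbTE ji) andbF mulr0.
Qed.

End Separable.

(** The Jacobian of the gradient is diagonal with entries [ddG i (u 0 i)], so its continuity is that
    of each [ddG i]. *)
Lemma C2_sep (R : realType) (m : nat) (G dG ddG : 'I_m -> R -> R) :
    (forall i (t : R), is_derive t 1 (G i) (dG i t)) ->
    (forall i (t : R), is_derive t 1 (dG i) (ddG i t)) ->
    (forall i, continuous (ddG i)) ->
  C2 (sep G).
Proof.
move=> GdG dGddG ddG_cont.
have gradE : grad (sep G) = fun u => \sum_i dG i (u 0 i) *: delta_mx 0 i.
  by apply/funext => u; rewrite (grad_sep GdG) [LHS]row_sum_delta;
    apply: eq_bigr => i _; rewrite mxE.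
have grad_diff u := is_diff_sum_coord dGddG (fun i => delta_mx 0 i : 'rV[R]_m) u.
split.
- by move=> u; have [] := is_diff_sep GdG u.
- by move=> u; rewrite gradE; have [] := grad_diff u.
- have -> : (fun u => jacobian (grad (sep G)) u) =
      fun u => \sum_i ddG i (u 0 i) *: delta_mx i i.
    apply/funext => u; rewrite gradE.
    have -> : \sum_i ddG i (u 0 i) *: delta_mx i i = diag_mx (\row_i ddG i (u 0 i)).
      by rewrite diag_mx_sum_delta; apply: eq_bigr => i _; rewrite mxE.
    apply/matrixP => i j.
    have [_ dE] := grad_diff u; rewrite /jacobian !mxE dE summxE.
    rewrite (bigD1 j)//= big1 ?addr0; last first.
      by move=> k kj; rewrite !mxE [j == k]eq_sym (negbTE kj) andbF mulr0.
    rewrite !mxE !eqxx mulr1 eq_sym; case: eqVneq => [->|]; rewrite ?mulr1// ?mulr0//.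
  apply: continuous_sum => i.
  have ddGc : continuous (fun u : 'rV[R]_m => ddG i (u 0 i)).
    move=> u; apply: (continuous_comp (g := ddG i)); last exact: ddG_cont.
    exact: coord_continuous.
  by move=> u; exact: cvgZr_tmp (ddGc u).
Qed.

(** * Comparison of the Euclidean norm with coordinates *)

Section EuclideanNorm.
Context {R : realType} {m : nat}.
Implicit Types u v : 'rV[R]_m.

Let edot_sqr u : edot u u = \sum_i `|u 0 i| ^+ 2.
Proof. by apply: eq_bigr => i _; rewrite -normrX ger0_norm ?sqr_ge0// expr2. Qed.

Lemma ler_norm_enorm u i : `|u 0 i| <= enorm u.
Proof.
rewrite /enorm edot_sqr -[leLHS]normr_id -[leLHS]sqrtr_sqr ler_wsqrtr//.
by rewrite (bigD1 i)//= lerDl sumr_ge0// => j _; exact: sqr_ge0.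
Qed.

(** Expanding the square of the sum gives the squares plus nonnegative cross terms. The bound later
    extracts a large coordinate from a large norm. *)
Lemma enorm_le_sum u : enorm u <= \sum_i `|u 0 i|.
Proof.
have s0 : 0 <= \sum_i `|u 0 i| by rewrite sumr_ge0.
rewrite -[leRHS]ger0_norm// -sqrtr_sqr ler_wsqrtr// edot_sqr expr2 mulr_suml.
apply: ler_sum => i _; rewrite expr2 ler_wpM2l// (bigD1 i)//= lerDl.
by rewrite sumr_ge0.
Qed.

(** Squaring and summing keeps [C] unchanged, so the Lipschitz constant of the gradient carries no
    factor depending on [m]. *)
Lemma enorm_lipschitz u v (C : R) : 0 <= C ->
  (forall i, `|u 0 i| <= C * `|v 0 i|) -> enorm u <= C * enorm v.
Proof.
move=> C0 uv; rewrite /enorm -{1}[C]ger0_norm// -sqrtr_sqr -sqrtrM ?sqr_ge0//.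
rewrite ler_wsqrtr// !edot_sqr mulr_sumr; apply: ler_sum => i _.
by rewrite -exprMn lerXn2r ?nnegrE ?mulr_ge0.
Qed.

End EuclideanNorm.

(** * Convexity and growth of separable functions *)

Lemma qform_diag (R : realType) (m : nat) (d u : 'rV[R]_m) :
  qform (diag_mx d) u = \sum_i d 0 i / 2 * u 0 i ^+ 2.
Proof.
rewrite /qform /edot mulr_suml; apply: eq_bigr => i _.
by rewrite tr_diag_mx mul_mx_diag mxE; field.
Qed.

Lemma convex_sep (R : realType) (m : nat) (h : 'I_m -> R -> R) :
    (forall i, convex_function setT (h i : convex_lmodType R^o -> R^o)) ->
  convex_function setT (sep h : convex_lmodType 'rV[R]_m -> R^o).
Proof.
move=> h_convex t x y _ _; rewrite /sep convRE !mulr_sumr -big_split/=.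
apply: ler_sum => i _; have := h_convex i t (x 0 i) (y 0 i).
by rewrite !in_setT !mxE => /(_ isT isT).
Qed.

Lemma coercive_sep (R : realType) (m : nat) (h : 'I_m -> R -> R) :
    (forall i, exists c, forall t, c <= h i t) ->
    (forall i (M : R), exists rho : R, forall t, rho < `|t| -> M < h i t) ->
  coercive enorm (EFin \o sep h).
Proof.
move=> /choice[c ch] h_gt M.
(* The level is raised to make up for the lower bounds of the other summands. *)
have /choice[rho hM] i := h_gt i (M - \sum_(j | j != i) c j).
exists (\sum_i `|rho i|) => u rho_u.
(* Otherwise the sum of the [|u 0 i|], hence the norm, would stay below the threshold. *)
have [i rho_i] : exists i, `|rho i| < `|u 0 i|.
  apply: contrapT => /forallNP u_rho; have := lt_le_trans rho_u (enorm_le_sum u).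
  by rewrite ltNge ler_sum// => i _; have /negP := u_rho i; rewrite -leNgt.
rewrite /= lte_fin /sep (bigD1 i)//=.
have := hM i _ (le_lt_trans (ler_norm _) rho_i); rewrite ltrBlDr => /lt_le_trans.
by apply; rewrite lerD2l ler_sum.
Qed.

Lemma bounded_below_sep (R : realType) (m : nat) (h : 'I_m -> R -> R) :
  (forall i, exists c, forall t, c <= h i t) -> bounded_below (EFin \o sep h).
Proof.
by move=> /choice[c ch]; exists (\sum_i c i) => u; rewrite /= lee_fin ler_sum.
Qed.

(* Freezing all coordinates but the [i]-th at points where the [g j] are finite
   shifts [g i] by a constant. *)
Lemma esep_slice (R : realType) (m : nat) (g : 'I_m -> R -> \bar R)
    (a : 'I_m -> R) (i : 'I_m) :
    (forall j, g j (a j) \is a fin_num) ->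
  exists (c : R) (u : R -> 'rV[R]_m), (forall t, `|t| <= enorm (u t)) /\
    forall t, g i t \is a fin_num -> esep g (u t) = (fine (g i t) + c)%:E.
Proof.
move=> ga; exists (\sum_(j | j != i) fine (g j (a j))).
exists (fun t => \row_j if j == i then t else a j); split => [t|t gt].
  by rewrite (le_trans _ (ler_norm_enorm _ i))// mxE eqxx.
rewrite /esep (bigD1 i)//= mxE eqxx EFinD fineK// -sumEFin; congr (_ + _)%E.
by apply: eq_bigr => j /negbTE ji; rewrite mxE ji fineK.
Qed.

(** * Finite bounds on second derivatives *)

Lemma d2_bounds (R : realType) (S : set R) (g : R -> R) :
    S !=set0 -> (0 <= inf_d2 S g)%E -> (sup_d2 S g < +oo)%E ->
  [/\ inf_d2 S g \is a fin_num, sup_d2 S g \is a fin_num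
    & forall t, S t -> fine (inf_d2 S g) <= derive1n 2 g t <= fine (sup_d2 S g)].
Proof.
move=> [s Ss] inf_ge0 sup_lty.
have g_inf t : S t -> (inf_d2 S g <= (derive1n 2 g t)%:E)%E.
  by move=> St; apply: ereal_inf_lbound; exists t.
have g_sup t : S t -> ((derive1n 2 g t)%:E <= sup_d2 S g)%E.
  by move=> St; apply: ereal_sup_ubound; exists t.
(* The value at [s] keeps the infimum below [+oo] and the supremum above [-oo], so [fine] is
   faithful on both. *)
have inf_fin : inf_d2 S g \is a fin_num.
  by rewrite ge0_fin_numE// (le_lt_trans (g_inf s Ss)) ?ltry.
have sup_fin : sup_d2 S g \is a fin_num.
  by rewrite fin_real// sup_lty (lt_le_trans _ (g_sup s Ss)) ?ltNyr.
by split => // t St; rewrite -!lee_fin !fineK// g_inf// g_sup.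
Qed.

Lemma is_derive_half_sqr (R : realType) (c t : R) :
  is_derive t 1 (fun s => c / 2 * s ^+ 2) (c * t).
Proof.
have -> : c * t = (c / 2) *: ((2%:R * t ^+ 1) *: (1 : R)).
  by rewrite /GRing.scale/=; field.
exact: (is_deriveZ (c / 2) (is_deriveX 2 (is_derive_id t 1))).
Qed.

(** * Assembly of smoothness, relative convexity, agreement and growth *)

Theorem proposition4 (R : realType) (m : nat)
    (X Z Zt Zf : finHilbertType R)
    (A : {linear X -> 'rV[R]_m})
    (Psi : Z -> \bar R) (L : {linear X -> Z})
    (mu : R) (B : {linear Z -> Zt})
    (Delta : set Zf) (C : {linear X -> Zf})
    (f : 'rV[R]_m -> \bar R) (fi : 'I_m -> R -> \bar R) (r : R -> R) :
  let Pi := Pi_set (C @^-1` Delta) A in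
  let Lam := diag_mx (\row_(i < m) fine (inf_d2 (Pi i) (fine \o fi i))) in
  let ft := sep (fun i => extend (Pi i) (fi i) r) in
  let K := (\big[maxe/-oo]_(i < m) sup_d2 (Pi i) (fine \o fi i)
            + sup_d2 setT r)%E in
  Gamma0 Psi -> coercive (fun z : Z => `|z|) Psi ->
  0 < mu ->
  closed Delta -> convex_set Delta ->
  (exists x, (Psi (L x) < +oo)%E /\ Delta (C x)) ->
  Gamma0 f ->
  (forall u, f u = esep fi u) ->
  (forall i, Gamma0 (fi i)) ->
  (forall i, eC2_over (Pi i) (fi i)) ->
  (forall i, (sup_d2 (Pi i) (fine \o fi i) < +oo)%E) ->
  (forall i, (0 <= inf_d2 (Pi i) (fine \o fi i))%E) ->
  Lam != 0 ->
  C2_over setT r ->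
  convex_function setT r ->
  (0 <= inf_d2 setT r)%E ->
  (sup_d2 setT r < +oo)%E ->
  r 0 = 0 -> derive1 r 0 = 0 -> derive1n 2 r 0 = 0 ->
  [/\ [/\ C2 ft,
          (K < +oo)%E
        & forall u v : 'rV[R]_m,
            ((enorm (grad ft u - grad ft v))%:E
             <= K * (enorm (u - v))%:E)%E],
      convex_function setT (fun u : 'rV[R]_m => ft u - qform Lam u),
      forall x, Delta (C x) -> f (A x) = (ft (A x))%:E
    & r t / t @[t --> +oo] --> +oo ->
      (coercive enorm f -> coercive enorm (EFin \o ft)) /\
      (bounded_below f -> bounded_below (EFin \o ft))].
Proof.
move=> Pi Lam ft K _ _ _ _ _ [x0 [_ Cx0]] _ fE _ fi_C2 sup_lty inf_ge0 Lam0.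
move=> r_C2 _ r_inf r_sup r0 r1_0 r2_0.
pose g i : R -> R := fine \o fi i.
have Pi_in x i : Delta (C x) -> Pi i (A x ord0 i).
  move=> Cx; apply/andP; split.
    by apply: ereal_inf_lbound; exists x.
  by apply: ereal_sup_ubound; exists x.
have Pi0 i : Pi i !=set0 by exists (A x0 ord0 i); exact: Pi_in.
pose a i := ereal_inf [set (A x ord0 i)%:E | x in C @^-1` Delta].
pose b i := ereal_sup [set (A x ord0 i)%:E | x in C @^-1` Delta].
have Pi_itv i : Pi i = [set t | (a i <= t%:E <= b i)%E] by [].
have gC2 i : C2_over (Pi i) (g i) by have [] := fi_C2 i.
have fi_fin i t : Pi i t -> fi i t \is a fin_num.
  by move=> Pt; have [/(_ t Pt)/nbhs_singleton] := fi_C2 i.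
have proj_in i t : Pi i (itv_proj (Pi i) t) := itv_proj_in (Pi_itv i) (Pi0 i) t.
pose lam i := fine (inf_d2 (Pi i) (g i)).
pose M i := fine (sup_d2 (Pi i) (g i)).
pose N := fine (sup_d2 setT r).
have lam_ge0 i : 0 <= lam i := fine_ge0 (inf_ge0 i).
have g2_bounds i t : Pi i t -> lam i <= derive1n 2 (g i) t <= M i.
  by have [_ _] := d2_bounds (Pi0 i) (inf_ge0 i) (sup_lty i); apply.
have g2_ge0 i t : Pi i t -> 0 <= derive1n 2 (g i) t.
  by move=> Pt; have /andP[lam_le _] := g2_bounds i t Pt; exact: le_trans lam_le.
have [_ N_fin r2_bounds] := d2_bounds (ex_intro _ 0 I) r_inf r_sup.
have r2_ge0 t : 0 <= derive1n 2 r t.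
  by have /andP[inf_le _] := r2_bounds t I; exact: le_trans (fine_ge0 r_inf) inf_le.
have r2_leN t : derive1n 2 r t <= N by have /andP[] := r2_bounds t I.
pose F i := extend (Pi i) (fi i) r.
pose dF i := extend_d1 (S := Pi i) (fi i) r.
pose ddF i := extend_d2 (S := Pi i) (fi i) r.
have FdF i (t : R) : is_derive t 1 (F i) (dF i t).
  exact: (is_derive_extend (Pi_itv i) (Pi0 i) (gC2 i) r_C2 r0 r1_0).
have dFddF i (t : R) : is_derive t 1 (dF i) (ddF i t).
  exact: (is_derive_extend_d1 (Pi_itv i) (Pi0 i) (gC2 i) r_C2 r1_0 r2_0).
have ddF_cont i : continuous (ddF i).
  exact: (continuous_extend_d2 (Pi_itv i) (Pi0 i) (gC2 i) r_C2).
have ddF_ge i t : lam i <= ddF i t.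
  have /andP[lam_le _] := g2_bounds i _ (proj_in i t).
  by apply: le_trans lam_le _; rewrite lerDl.
have ddF_le i t : ddF i t <= M i + N.
  by rewrite lerD//; have /andP[] := g2_bounds i _ (proj_in i t).
have F_id i t : Pi i t -> F i t = fine (fi i t).
  by move=> Pt; exact: (extend_id (Pi0 i)).
have F_cont i : continuous (F i).
  move=> t; apply: differentiable_continuous; apply/derivable1_diffP.
  by have [] := FdF i t.
(* A nonzero [Lam] supplies an index, so the maximum defining [Kmax] runs over a nonempty family and
   is not its default [-oo]. *)
have [i0 _] : exists i : 'I_m, lam i != 0.
  apply/existsP; apply: contraNT Lam0 => /existsPn lam0.
  apply/eqP/matrixP => i j; rewrite !mxE; have := lam0 i; rewrite negbK => /eqP.
  by rewrite /lam /g => ->; rewrite mul0rn.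
pose Kmax := (\big[maxe/-oo]_(i < m) sup_d2 (Pi i) (g i))%E.
have sup_le i : ((M i)%:E <= Kmax)%E.
  have [_ M_fin _] := d2_bounds (Pi0 i) (inf_ge0 i) (sup_lty i).
  by rewrite fineK//; exact: le_bigmax.
have Kmax_lty : (Kmax < +oo)%E.
  rewrite /Kmax; elim/big_ind : _ => [|x y x_lty y_lty|i _].
  - exact: lt_trans (ltNyr 0) (ltry 0).
  - by rewrite gt_max x_lty.
  - exact: sup_lty.
have Kmax_fin : Kmax \is a fin_num.
  by rewrite fin_real// Kmax_lty (lt_le_trans _ (sup_le i0)) ?ltNyr.
have KE : K = (fine Kmax + N)%:E by rewrite EFinD !fineK.
have M_leK i : M i <= fine Kmax by rewrite -lee_fin (fineK Kmax_fin).
have ddF_norm i t : `|ddF i t| <= fine Kmax + N.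
  rewrite ger0_norm; last by exact: le_trans (lam_ge0 i) (ddF_ge i t).
  by apply: le_trans (ddF_le i t) _; rewrite lerD2r.
have K_ge0 : 0 <= fine Kmax + N := le_trans (normr_ge0 _) (ddF_norm i0 0).
have F_gt i (L0 : R) : r t / t @[t --> +oo] --> +oo ->
    (exists rho : R, forall t, Pi i t -> rho < `|t| -> L0 < fine (fi i t)) ->
  exists rho : R, forall t, rho < `|t| -> L0 < F i t.
  by move=> rlim; exact: (extend_gt (Pi_itv i) (Pi0 i) r0 rlim (g2_ge0 i)).
split.
- split; [exact: C2_sep FdF dFddF ddF_cont|by rewrite KE ltry|move=> u v].
  rewrite KE -EFinM lee_fin; apply: enorm_lipschitz => // i.
  (* Each gradient component depends on its own coordinate alone, which leaves a one-dimensional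
     Lipschitz bound. *)
  rewrite !(grad_sep FdF) !mxE.
  exact: lipschitz_of_derive (dFddF i) (ddF_norm i).
(* [qform Lam] is separable too, so the claim reduces to [lam i <= ddF i t]. *)
- pose h i t := F i t - lam i / 2 * t ^+ 2.
  have -> : (fun u => ft u - qform Lam u) = sep h.
    apply/funext => u; rewrite qform_diag /ft /sep -sumrB.
    by apply: eq_bigr => i _; rewrite mxE.
  apply: convex_sep => i.
  apply: (@derive2_ge0_convex _ _ (fun t => dF i t - lam i * t)
    (fun t => ddF i t - lam i)).
  + by move=> t; exact: is_deriveB (FdF i t) (is_derive_half_sqr (lam i) t).
  + move=> t; apply: is_deriveB (dFddF i t) _.
    by have := is_derive_affine (lam i) 0 0 t; under eq_fun do rewrite subr0 addr0.
  + by move=> t; rewrite subr_ge0.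
- move=> x Cx; rewrite fE /esep /ft /sep -sumEFin; apply: eq_bigr => i _.
  by rewrite -/(F i) F_id ?fineK// ?fi_fin//; exact: Pi_in.
- move=> rlim.
  (* The other coordinates are frozen at those of [A x0], where every [fi j] is finite. *)
  have slice i := esep_slice i (fun j => fi_fin j _ (Pi_in x0 j Cx0)).
  (* One level [L0] suffices: beyond the threshold it is a lower bound, and continuity covers the
     remaining compact interval. *)
  have F_below i (L0 : R) :
      (exists rho : R, forall t, Pi i t -> rho < `|t| -> L0 < fine (fi i t)) ->
    exists c, forall t, c <= F i t.
    by move=> /(F_gt _ _ rlim)[rho]; exact: gt_outside_bounded_below.
  split.
  + move=> f_coercive.
    have g_gt i (L0 : R) :
        exists rho : R, forall t, Pi i t -> rho < `|t| -> L0 < fine (fi i t).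
      have [c [u [tu uE]]] := slice i; have [rho f_gt] := f_coercive (L0 + c).
      exists rho => t Pt rho_t; have := f_gt _ (lt_le_trans rho_t (tu t)).
      by rewrite fE uE ?fi_fin// lte_fin ltrD2r.
    apply: coercive_sep => i; first exact: (F_below i 0).
    by move=> L0; exact: F_gt.
  + move=> [c0 f_ge]; apply: bounded_below_sep => i.
    have [c [u [_ uE]]] := slice i.
    (* On [Pi i] the slice gives [fi i] at least [c0 - c]; subtracting 1 makes the inequality
       strict, and it holds beyond any threshold. *)
    apply: (F_below i (c0 - c - 1)); exists 0 => t Pt _.
    by have := f_ge (u t); rewrite fE uE ?fi_fin// lee_fin; lra.
Qed.
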